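(* Let $\theta_1,\dots,\theta_r$ be real numbers, and let $m$, $d$, $h_{k,j}$ be as defined in the context. The one-parameter subgroup $\Gamma_\theta=\{(e^{i\theta_1y},\dots,e^{i\theta_ry}) : y\in\mathbb{R}\}$ is equidistributed in $$H_\theta=\left\{\left(z_1^d,\dots,z_m^d,\prod_{k=1}^m z_k^{h_{k,m+1}},\dots,\prod_{k=1}^m z_k^{h_{k,r}}\right) : (z_1,\dots,z_m)\in\mathbb{T}^m\right\},$$ that is, for every continuous $f:\mathbb{T}^r\to\mathbb{C}$ one has $$\frac1X\int_0^Xf\left(e^{i\theta_1y},\dots,e^{i\theta_ry}\right)\mathrm{d}y\underset{X\to+\infty}{\longrightarrow}\int_{H_\theta}f\,\mathrm{d}\mu_{H_\theta},$$ where $\mu_{H_\theta}$ is the normalized Haar measure on $H_\theta$.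
   Context: $\mathbb{T}=\{z\in\mathbb{C}:|z|=1\}$. Let $m=\dim_{\mathbb{Q}}\mathrm{Span}_{\mathbb{Q}}(\theta_1,\dots,\theta_r)$. After reindexing the $\theta_i$, it is assumed that $\{\theta_1,\dots,\theta_m\}$ is a basis of this $\mathbb{Q}$-vector space, and one writes $\theta_j=\sum_{k=1}^m b_{k,j}\theta_k$ for $m+1\le j\le r$, with $b_{k,j}\in\mathbb{Q}$. Let $d\ge1$ be the least common multiple of the denominators of all the $b_{k,j}$ ($d=1$ if $m=r$), and $h_{k,j}=d\,b_{k,j}\in\mathbb{Z}$. *)

(* Defs.v *)
From HB Require Import structures.
From mathcomp Require Import all_boot all_order all_algebra.
From mathcomp Require Import all_classical all_reals all_analysis.
From mathcomp Require Import complex.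
Set Implicit Arguments.
Unset Strict Implicit.
Unset Printing Implicit Defensive.
Import Order.TTheory GRing.Theory Num.Theory.
Import numFieldNormedType.Exports.
Local Open Scope classical_set_scope.
Local Open Scope ring_scope.
Local Open Scope complex_scope.

(* The usual topology of the complex numbers, given by the modulus. *)
HB.instance Definition _ (R : realType) := PseudoPointedMetric.copy R[i] R[i]^o.

Section RationalRelations.
Variable R : realType.

Definition rat_span r (theta : 'I_r -> R) : set R :=
  [set x | exists a : 'I_r -> rat, x = \sum_i ratr (a i) * theta i].

Definition rat_free r (theta : 'I_r -> R) : Prop :=
  forall a : 'I_r -> rat, \sum_i ratr (a i) * theta i = 0 -> forall i, a i = 0.

Definition rat_basis m (e : 'I_m -> R) (V : set R) : Prop :=
  rat_free e /\ rat_span e = V.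

End RationalRelations.

Section Denominators.
Variables m n : nat.

Definition lcm_denom (b : 'M[rat]_(m, n)) : nat :=
  \big[lcmn/1%N]_(k < m) \big[lcmn/1%N]_(j < n) `|denq (b k j)|%N.

(* The rational d * b k j is an integer (see [cleared_coefE]); numq reads it
   as an element of int. *)
Definition cleared_coef (b : 'M[rat]_(m, n)) : 'M[int]_(m, n) :=
  \matrix_(k, j) numq ((lcm_denom b)%:R * b k j).

Lemma dvdn_lcm_denom (b : 'M[rat]_(m, n)) k j :
  (`|denq (b k j)| %| lcm_denom b)%N.
Proof.
apply: (@dvdn_trans (\big[lcmn/1%N]_(j < n) `|denq (b k j)|%N)).
  by rewrite (bigD1 j) //= dvdn_lcml.
by rewrite /lcm_denom (bigD1 k) //= dvdn_lcml.
Qed.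

Lemma cleared_coefE (b : 'M[rat]_(m, n)) k j :
  (cleared_coef b k j)%:~R = (lcm_denom b)%:R * b k j.
Proof.
have /dvdnP[q dE] := dvdn_lcm_denom b k j.
rewrite mxE dE natrM -mulrA pmulrn.
have -> : `|denq (b k j)|%N%:R * b k j = (numq (b k j))%:~R.
  by rewrite pmulrn absz_denq mulrC numqE.
by rewrite -intrM numq_int.
Qed.

End Denominators.

Section Torus.
Variable R : realType.

Definition expi (t : R) : R[i] := cos t +i* sin t.

Definition torus r : set 'rV[R[i]]_r := [set z | forall i, `|z 0 i| = 1].
Arguments torus : clear implicits.

Definition tmul r (z w : 'rV[R[i]]_r) : 'rV[R[i]]_r :=
  map2_mx (fun x y => x * y) z w.

Definition one_param r (theta : 'I_r -> R) (y : R) : 'rV[R[i]]_r :=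
  \row_i expi (theta i * y).

Definition Hsub m n (b : 'M[rat]_(m, n)) : set 'rV[R[i]]_(m + n) :=
  [set row_mx (\row_k z 0 k ^+ lcm_denom b)
              (\row_j \prod_(k < m) z 0 k ^ cleared_coef b k j)
  | z in torus m].

Definition borel_rV r := g_sigma_algebraType (@open 'rV[R[i]]_r).

(* The normalized Haar measure of a compact subgroup H of the torus, seen as a
   Borel measure on the ambient space that is carried by H. *)
Definition normalized_haar r (H : set 'rV[R[i]]_r)
    (mu : {measure set (borel_rV r) -> \bar R}) : Prop :=
  [/\ mu H = 1%E, mu (~` H) = 0%E &
      forall (a : 'rV[R[i]]_r) (A : set (borel_rV r)),
        H a -> measurable A -> A `<=` H -> mu (tmul a @` A) = mu A].

End Torus.
Arguments torus : clear implicits.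
Arguments Hsub R {m n} b.

Definition cintegral (R : realType) (d : measure_display)
    (T : measurableType d) (mu : {measure set T -> \bar R}) (D : set T)
    (f : T -> R[i]) : R[i] :=
  (\int[mu]_(x in D) complex.Re (f x)) +i* (\int[mu]_(x in D) complex.Im (f x)).

(* Main.v *)
Require Import Defs.
From mathcomp Require Import all_boot all_order all_algebra.
From mathcomp Require Import all_classical all_reals all_analysis.
From mathcomp Require Import complex.
From mathcomp Require Import ring lra zify.
Import Order.TTheory GRing.Theory Num.Theory.
Import numFieldNormedType.Exports.
Local Open Scope classical_set_scope.
Local Open Scope ring_scope.
Local Open Scope complex_scope.

(** The closure of the line [y |-> one_param theta y] in the torus is a compact
    group, and a line that is dense in a compact group is equidistributed in it.
    The proof has these two halves.

    Density.  Put [w k = theta k / d] for the basis frequencies.  The map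
    [Hmap] sending [z] to [(z_k ^ d, prod_k z_k ^ h_kj)] is a continuous
    homomorphism of the [m]-torus onto [H], and it carries the line of
    frequencies [w] to the line of frequencies [theta].  So density in [H]
    ([one_param_dense]) follows from Kronecker's theorem for the rationally free
    family [w] ([kronecker]).  The latter is proved by Bohr's method: if the
    line stayed away from [c], the product [prod_k (1 + u_k) ^ 2q / u_k ^ q],
    with [u_k = expi (w k * y) / c_k], would be smaller than [4 ^ (q m)] by a
    factor exponential in [q]; but its mean value in [y] is its constant
    coefficient, ['C(2q, q) ^ m], because freeness makes all other frequencies
    nonzero, and this is smaller than [4 ^ (q m)] only by a factor polynomial
    in [q].

    Equidistribution.  Let [g] be a real continuous function on the torus and
    [gamma] the line.  By uniform continuity and density, finitely many points
    [gamma (s_i)] with [s_i >= 0] have the property that [H] splits into Borel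
    cells such that, for every [x] in [H], the function [z |-> g (x z)] is
    within [e] of its value at [gamma (s_i)] on the [i]-th cell.  Let [w_i] be
    the Haar measures of the cells.  Since Haar measure is invariant under
    translation by [gamma y], the integral of [g] over [H] is within [e] of
    [sum_i w_i * g (gamma (y + s_i))], for every [y] ([haar_mean_approx]).
    Averaging over [y] in [0, X], the shift by [s_i] changes each time average
    only by [O(s_i / X)], so the time average of [g] converges to its space
    average ([equidistribution_real]).  The theorem is this statement for the
    real and imaginary parts of [f].  *)

Set Implicit Arguments.
Unset Strict Implicit.
Unset Printing Implicit Defensive.

(** * The exponential map onto the circle, and mean values of exponential sums *)

Section Expi.
Variable R : realType.
Implicit Types (s t : R).

Lemma expiD s t : expi (s + t) = expi s * expi t.
Proof. by rewrite /expi cosD sinD; simpc; congr (_ +i* _); ring. Qed.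

Lemma expi0 : expi (0 : R) = 1.
Proof. by rewrite /expi cos0 sin0. Qed.

Lemma norm_expi t : `|expi t| = 1.
Proof. by rewrite normc_def /= cos2Dsin2 sqrtr1. Qed.

Lemma expi_neq0 t : expi t != 0.
Proof. by rewrite -normr_eq0 norm_expi oner_eq0. Qed.

Lemma expiN t : expi (- t) = (expi t)^-1.
Proof.
by apply: (mulfI (expi_neq0 t)); rewrite -expiD subrr expi0 divff ?expi_neq0.
Qed.

Lemma expi_sum (I : finType) (F : I -> R) :
  expi (\sum_i F i) = \prod_i expi (F i).
Proof. by rewrite (big_morph _ expiD expi0). Qed.

Lemma expiMn t n : expi (n%:R * t) = expi t ^+ n.
Proof.
elim: n => [|n IH]; first by rewrite mul0r expi0.
by rewrite -natr1 mulrDl mul1r expiD IH exprSr.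
Qed.

Lemma expiMz t (k : int) : expi (k%:~R * t) = expi t ^ k.
Proof.
case: k => n; first exact: expiMn.
by rewrite NegzE mulrNz mulNr expiN expiMn -exprnN.
Qed.

Lemma expi_surj (z : R[i]) : `|z| = 1 -> exists2 t, `|t| <= pi & z = expi t.
Proof.
case: z => x y; rewrite normc_def /= => -[h].
have {h} xy : x ^+ 2 + y ^+ 2 = 1.
  have : Num.sqrt (x ^+ 2 + y ^+ 2) ^+ 2 = 1 by rewrite h expr1n.
  by rewrite sqr_sqrtr // addr_ge0 ?sqr_ge0.
have x1 : -1 <= x <= 1.
  have y0 := sqr_ge0 y; apply/andP; split; nra.
have sE : sin (acos x) = `|y|.
  by rewrite sin_acos // -xy addrAC subrr add0r sqrtr_sqr.
have aE : `|acos x| <= pi by rewrite ger0_norm ?acos_ge0 ?acos_lepi.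
have [y0|y0] := leP 0 y.
  by exists (acos x); rewrite // /expi acosK ?in_itv//= sE ger0_norm.
exists (- acos x); first by rewrite normrN.
by rewrite /expi cosN sinN acosK ?in_itv//= sE ltr0_norm // opprK.
Qed.

Lemma expi_neq1 t : t != 0 -> `|t| <= pi -> expi t != 1.
Proof.
move=> t0 tpi; apply/eqP => -[ct _].
have : `|t| = 0.
  apply: cos_inj; rewrite ?in_itv /= ?normr_ge0 ?tpi ?lexx ?pi_ge0 //.
  by rewrite cos0; have [?|?] := ler0P t; rewrite ?cosN.
by move/eqP; rewrite normr_eq0 (negbTE t0).
Qed.

End Expi.

(** Since [rho <= exp (- h)] with [h = 1 - rho], this is the growth of
    [exp (q * h)], which already beats a polynomial of degree [m] through the
    term of degree [m + 1] of its series. *)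
Lemma geometric_lt_polynomial (R : realType) (rho : R) m : 0 <= rho < 1 ->
  exists q : nat, rho ^+ q * ((2 * q).+1)%:R ^+ m < 1.
Proof.
move=> /andP[rho0 rho1]; pose h := 1 - rho.
have h0 : 0 < h by rewrite /h; lra.
(* [2 q + 1 <= 3 q] once [q > 0]; any [q > K] then satisfies
   [(3 q) ^ m < (q h) ^ (m + 1) / (m + 1)!]. *)
pose K := 3 ^+ m * (m.+1)`!%:R / h ^+ m.+1.
have K0 : 0 <= K by rewrite /K !mulr_ge0 ?invr_ge0 ?exprn_ge0 ?ler0n // ltW.
pose q := Num.bound K; exists q.
have qK : K < q%:R by rewrite /q archi_boundP.
have q0 : (0 < q)%N by rewrite -(ltr_nat R); exact: le_lt_trans qK.
have rq : rho ^+ q <= (expR (q%:R * h))^-1.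
  rewrite -expRN -mulrN expRM_natl; apply: lerXn2r.
  - by rewrite nnegrE.
  - by rewrite nnegrE expR_ge0.
  - by apply: le_trans (expR_ge1Dx _); rewrite /h; lra.
have qh0 : 0 <= q%:R * h by rewrite mulr_ge0 ?ler0n ?ltW.
have e0 := expR_ge1Dxn m qh0.
have eK : (3 * q%:R) ^+ m < expR (q%:R * h).
  apply: lt_le_trans e0; apply: (@lt_trans _ _ ((q%:R * h) ^+ m.+1 / (m.+1)`!%:R)).
    rewrite ltr_pdivlMr ?ltr0n ?fact_gt0 // !exprMn [q%:R ^+ m.+1]exprS.
    move: qK; rewrite /K ltr_pdivrMr ?exprn_gt0 // => qK.
    have : 0 < (q%:R : R) ^+ m by rewrite exprn_gt0 ?ltr0n.
    move=> /ltr_pM2l => /(_ (3 ^+ m * (m.+1)`!%:R) (q%:R * h ^+ m.+1)).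
    rewrite qK => H.
    by move: H; congr (_ < _); ring.
  by rewrite ltrDr.
apply: (@le_lt_trans _ _ ((expR (q%:R * h))^-1 * (3 * q%:R) ^+ m)).
  apply: ler_pM => //; rewrite ?exprn_ge0 ?ler0n //.
  apply: lerXn2r; rewrite ?nnegrE ?mulr_ge0 ?ler0n //.
  by rewrite -natrM ler_nat; lia.
by rewrite mulrC ltr_pdivrMr ?expR_gt0 // mul1r.
Qed.

(** The row [2 q] of Pascal's triangle has [2 q + 1] entries with sum [4 ^ q],
    and the central one is the largest. *)
Lemma central_bin_ge q : (4 ^ q <= (2 * q).+1 * 'C(2 * q, q))%N.
Proof.
elim: q => // q IH.
have e1 : ((2 * q).+2 * 'C((2 * q).+1, q) = q.+1 * 'C((2 * q).+2, q.+1))%N.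
  exact: mul_bin_diag.
have e2 : ((2 * q).+1 * 'C(2 * q, q) = q.+1 * 'C((2 * q).+1, q.+1))%N.
  exact: mul_bin_diag.
have e3 : ('C((2 * q).+1, q.+1) = 'C((2 * q).+1, q))%N.
  rewrite -[in RHS](@bin_sub _ q); last by lia.
  by congr 'C(_, _); lia.
rewrite e3 in e2.
have -> : (2 * q.+1 = (2 * q).+2)%N by lia.
rewrite expnS; nia.
Qed.

Section Mean.
Variable R : realType.

(** Averaging over [t < N] singles out the coefficient of the constant
    exponential: the other terms give geometric sums, bounded uniformly in [N]. *)
Lemma bounded_exp_sum_coef (J : finType) (C z : J -> R[i]) (j0 : J) (B : R) :
  (forall j, `|z j| = 1) -> z j0 = 1 -> (forall j, j != j0 -> z j != 1) ->
  (forall t : nat, `|\sum_j C j * z j ^+ t| <= B%:C) ->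
  `|C j0| <= B%:C.
Proof.
move=> z1 zj0 zn1 HB.
pose K : R[i] := \sum_(j | j != j0) `|C j| * (2 / `|z j - 1|).
have avg (N : nat) : N%:R * `|C j0| <= N%:R * B%:C + K.
  have E : N%:R * C j0 = \sum_(t < N) \sum_j C j * z j ^+ t
     - \sum_(j | j != j0) C j * ((z j ^+ N - 1) / (z j - 1)).
    rewrite exchange_big (bigD1 j0) //=.
    rewrite (eq_bigr (fun=> C j0)); last by move=> i _; rewrite zj0 expr1n mulr1.
    rewrite sumr_const card_ord mulr_natl -[LHS]addr0 -addrA; congr (_ + _).
    apply/esym/eqP; rewrite subr_eq0; apply/eqP; apply: eq_bigr => j jj0.
    rewrite -mulr_sumr subrX1; congr (_ * _).
    by rewrite mulrAC divff ?mul1r // subr_eq0 zn1.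
  rewrite -[N%:R]normr_nat -normrM E (le_trans (ler_normB _ _)) //.
  rewrite normr_nat; apply: lerD.
    rewrite mulr_natl -[N in X in _ <= X]card_ord -sumr_const.
    by rewrite (le_trans (ler_norm_sum _ _ _)) // ler_sum.
  rewrite (le_trans (ler_norm_sum _ _ _)) // ler_sum // => j _.
  rewrite !normrM normfV ler_wpM2l // ler_wpM2r ?invr_ge0 //.
  by rewrite (le_trans (ler_normB _ _)) // normrX z1 expr1n normr1.
have K0 : 0 <= K by rewrite sumr_ge0 // => j _; rewrite !mulr_ge0 ?invr_ge0.
have EC : ((complex.Re `|C j0|)%:C = `|C j0|)%C by rewrite RRe_real ?normr_real.
have EK : ((complex.Re K)%:C = K)%C by rewrite RRe_real ?ger0_real.
move: avg; rewrite -EC -EK; set a := complex.Re _; set k := complex.Re _ => avg.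
rewrite lecR leNgt; apply/negP => Ba.
have k0 : 0 <= k by move: K0; rewrite -EK ler0c.
have : k / (a - B) < (Num.bound (k / (a - B)))%:R.
  by apply: archi_boundP; rewrite divr_ge0 // subr_ge0 ltW.
rewrite ltr_pdivrMr ?subr_gt0 //; set N := Num.bound _ => kN.
have := avg N.
rewrite -[N%:R](_ : (N%:R : R)%:C = _); last by rewrite rmorph_nat.
rewrite -!rmorphM -rmorphD /= lecR; lra.
Qed.

End Mean.

(** * Kronecker's theorem *)

Section Kronecker.
Variable R : realType.

(** Parallelogram law: [|1 + u| ^ 2 + |1 - u| ^ 2 = 4] on the unit circle. *)
Lemma norm_add1_sqr_le (u : R[i]) (delta : R) : 0 <= delta -> `|u| = 1 ->
  delta%:C <= `|u - 1| -> `|1 + u| ^+ 2 <= (4 - delta ^+ 2)%:C.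
Proof.
move=> d0 u1 du.
have h : delta%:C ^+ 2 <= `|u - 1| ^+ 2.
  by apply: lerXn2r; rewrite ?nnegrE ?normr_ge0 ?ler0c.
have e : `|u| ^+ 2 = 1 by rewrite u1 expr1n.
case: u {u1 du} h e => x y; rewrite -!add_Re2_Im2 -rmorphXn /= !lecR => h [e].
nra.
Qed.

(** Dividing by the [q]-th powers centres the spectrum: the frequency of index
    [J] vanishes when all [J k] equal [q], where the coefficient is a power of
    the central binomial coefficient. *)
Lemma trig_power_expansion (m q : nat) (w : 'I_m -> R) (d : 'I_m -> R[i]) (y : R) :
  \prod_k ((1 + expi (w k * y) * d k) ^+ (2 * q) / (expi (w k * y) * d k) ^+ q)
  = \sum_(J : {ffun 'I_m -> 'I_(2 * q).+1})
      (\prod_k ('C(2 * q, J k)%:R * d k ^+ J k / d k ^+ q))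
      * expi ((\sum_k ((J k)%:R - q%:R) * w k) * y).
Proof.
transitivity (\prod_k \sum_(j < (2 * q).+1)
  ('C(2 * q, j)%:R * d k ^+ j / d k ^+ q) * expi ((j%:R - q%:R) * w k * y)).
  apply: eq_bigr => k _; rewrite exprDn mulr_suml; apply: eq_bigr => j _.
  have -> : (j%:R - q%:R) * w k * y = j%:R * (w k * y) - q%:R * (w k * y) by ring.
  rewrite expr1n mul1r expiD expiN !expiMn !exprMn invfM.
  by rewrite -[_ *+ 'C(_, _)]mulr_natl; ring.
rewrite bigA_distr_bigA.
by apply: eq_bigr => J _; rewrite big_split /= mulr_suml expi_sum.
Qed.

(** Bohr's argument.  If no [y >= 0] works, the products expanded in
    [trig_power_expansion] are at most [(4 ^ q) ^ m * rho ^ q] for all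
    [y >= 0], with [rho < 1]; their constant coefficient ['C(2 q, q) ^ m]
    obeys the same bound, which is false for large [q].  Mean
    values are taken over positive times, so [y >= 0] comes out of the argument;
    it makes the translations of time averages go to the right. *)
Theorem kronecker (m : nat) (w : 'I_m -> R) (c : 'I_m -> R[i]) (delta : R) :
  rat_free w -> (forall k, `|c k| = 1) -> 0 < delta ->
  exists2 y, 0 <= y & forall k, `|expi (w k * y) - c k| < delta%:C.
Proof.
move=> wfree c1 d0; apply: contrapT => nex.
have bad y : 0 <= y -> exists k, delta%:C <= `|expi (w k * y) - c k|.
  move=> y0; apply: contrapT => nk; apply: nex; exists y => // k.
  rewrite real_ltNge ?normr_real //; last by apply/complex_realP; exists delta.
  by apply/negP => h; apply: nk; exists k.
pose d k := (c k)^-1.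
have d1 k : `|d k| = 1 by rewrite normfV c1 invr1.
pose u k y := expi (w k * y) * d k.
have u1 k y : `|u k y| = 1 by rewrite normrM norm_expi d1 mulr1.
have uE k y : `|u k y - 1| = `|expi (w k * y) - c k|.
  have cd : c k * d k = 1 by rewrite divff // -normr_eq0 c1 oner_eq0.
  by rewrite -[X in _ - X]cd -mulrBl normrM d1 mulr1.
pose rho := 1 - delta ^+ 2 / 4.
have u4 k y : `|1 + u k y| ^+ 2 <= 4.
  have : `|1 + u k y| <= 2 by rewrite (le_trans (ler_normD _ _)) // normr1 u1.
  move=> h; rewrite (_ : 4 = 2 ^+ 2); last by rewrite expr2 -natrM.
  by apply: lerXn2r; rewrite ?nnegrE.
have ub y : 0 <= y -> \prod_k (`|1 + u k y| ^+ 2 / 4) <= rho%:C.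
  move=> y0; have [k hk] := bad y y0.
  rewrite (bigD1 k) //= -[rho%:C]mulr1; apply: ler_pM.
  - by rewrite mulr_ge0 ?exprn_ge0 ?invr_ge0.
  - by apply: prodr_ge0 => i _; rewrite mulr_ge0 ?exprn_ge0 ?invr_ge0.
  - rewrite ler_pdivrMr //; apply: le_trans (norm_add1_sqr_le (ltW d0) (u1 k y) _) _.
      by rewrite uE.
    rewrite (_ : 4 = (4 : R)%:C); last by rewrite rmorph_nat.
    by rewrite -rmorphM lecR /rho; lra.
  - apply: prodr_ile1 => i _; rewrite mulr_ge0 ?exprn_ge0 ?invr_ge0 //=.
    by rewrite ler_pdivrMr // mul1r.
have rho0 : 0 <= rho.
  rewrite -ler0c; apply: le_trans (ub 0 (lexx _)).
  by apply: prodr_ge0 => i _; rewrite mulr_ge0 ?exprn_ge0 ?invr_ge0.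
have rho1 : rho < 1 by rewrite /rho ltrBlDr ltrDl divr_gt0 ?exprn_gt0.
have [q hq] := @geometric_lt_polynomial R rho m (introT andP (conj rho0 rho1)).
pose J0 : {ffun 'I_m -> 'I_(2 * q).+1} := [ffun=> inord q].
have J0E k : J0 k = q :> nat by rewrite ffunE inordK //; lia.
pose lam (J : {ffun 'I_m -> 'I_(2 * q).+1}) := \sum_k ((J k)%:R - q%:R) * w k.
have lam0 : lam J0 = 0.
  by rewrite /lam big1 // => k _; rewrite J0E subrr mul0r.
have lamN0 J : J != J0 -> lam J != 0.
  apply: contra => /eqP lJ; apply/eqP/ffunP => k; apply/val_inj.
  have := wfree (fun k => (J k)%:R - q%:R).
  move=> /(_ _ k)/wrap[|].
    rewrite -[RHS]lJ; apply: eq_bigr => i _.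
    by rewrite rmorphB !rmorph_nat.
  by move/eqP; rewrite subr_eq0 eqr_nat => /eqP /= ->; rewrite J0E.
(* The time is sampled at the multiples of [tau].  With [|lam J * tau| <= pi]
   for every [J], a nonzero frequency cannot be sampled to the value 1. *)
pose S := 1 + \sum_J `|lam J|.
have S1 : 1 <= S by rewrite lerDl sumr_ge0.
pose tau : R := pi / S.
have S0 : 0 < S by exact: lt_le_trans S1.
have tau0 : 0 < tau by rewrite divr_gt0 ?pi_gt0.
have small J : `|lam J * tau| <= pi.
  rewrite normrM (gtr0_norm tau0) mulrA ler_pdivrMr // mulrC ler_wpM2l ?pi_ge0 //.
  rewrite /S (bigD1 J) //= addrCA lerDl addr_ge0 // sumr_ge0 //.
pose C (J : {ffun 'I_m -> 'I_(2 * q).+1}) :=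
  \prod_k ('C(2 * q, J k)%:R * d k ^+ J k / d k ^+ q).
have := @bounded_exp_sum_coef R _ C (fun J => expi (lam J * tau)) J0
  ((4 ^+ q) ^+ m * rho ^+ q).
move=> /(_ _)/wrap[|]; first by move=> J; exact: norm_expi.
move=> /(_ _)/wrap[|]; first by rewrite lam0 mul0r expi0.
move=> /(_ _)/wrap[|].
  by move=> J JJ0; apply: expi_neq1 => //; rewrite mulf_neq0 ?lamN0 ?gt_eqF.
move=> /(_ _)/wrap[|].
  move=> t; pose y := tau * t%:R.
  have y0 : 0 <= y by rewrite mulr_ge0 ?ler0n ?ltW.
  rewrite (eq_bigr (fun J => C J * expi (lam J * y))); last first.
    by move=> J _; rewrite -expiMn /y; congr (_ * expi _); ring.
  rewrite -trig_power_expansion normr_prod.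
  rewrite (eq_bigr (fun k => 4 ^+ q * (`|1 + u k y| ^+ 2 / 4) ^+ q)); last first.
    move=> k _; rewrite normrM normfV !normrX -/(u k y) u1 expr1n invr1 mulr1.
    by rewrite -exprMn mulrCA divff ?mulr1 ?exprM // pnatr_eq0.
  rewrite big_split /= prodr_const card_ord prodrXl rmorphM !rmorphXn.
  rewrite rmorph_nat ler_wpM2l ?exprn_ge0 //.
  apply: lerXn2r; rewrite ?nnegrE ?normr_ge0 ?ler0c ?ub //.
  by apply: prodr_ge0 => i _; rewrite mulr_ge0 ?exprn_ge0 ?invr_ge0.
rewrite /C (eq_bigr (fun=> ('C(2 * q, q)%:R))); last first.
  move=> k _; rewrite J0E -mulrA divff ?mulr1 // expf_neq0 //.
  by rewrite -normr_eq0 d1 oner_eq0.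
rewrite prodr_const card_ord normrX normr_nat.
rewrite (_ : 'C(2 * q, q)%:R = ('C(2 * q, q)%:R : R)%:C); last first.
  by rewrite rmorph_nat.
rewrite -rmorphXn lecR leNgt => /negP; apply.
set N := ((2 * q).+1)%:R in hq.
have N0 : 0 < N ^+ m by rewrite exprn_gt0 // ltr0n.
rewrite -(ltr_pM2r N0) -mulrA.
apply: (@lt_le_trans _ _ ((4 ^+ q) ^+ m)).
  by rewrite -[ltRHS]mulr1 ltr_pM2l ?exprn_gt0 // !exprn_gt0.
rewrite -exprMn; apply: lerXn2r; rewrite ?nnegrE ?mulr_ge0 ?exprn_ge0 ?ler0n //.
by rewrite -natrX -natrM ler_nat mulnC central_bin_ge.
Qed.

End Kronecker.

(** * Topology of the torus *)

Section Topology.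
Variable R : realType.

Lemma cvg_mx_coord (T : Type) (F : set_system T) (FF : Filter F)
    (U : topologicalType) m n (f : T -> 'M[U]_(m, n)) (l : 'M[U]_(m, n)) :
  (forall i j, f x i j @[x --> F] --> l i j) -> f x @[x --> F] --> l.
Proof.
move=> fl A [P lP PA]; near=> x; apply: PA => i j /=.
by move: i j; near: x; apply: filter_forall => i; apply: filter_forall => j;
  exact: fl (lP i j).
Unshelve. all: by end_near. Qed.

Lemma cvg_complex (T : Type) (F : set_system T) (FF : Filter F)
    (f : T -> R[i]) (z : R[i]) :
  complex.Re (f x) @[x --> F] --> complex.Re z ->
  complex.Im (f x) @[x --> F] --> complex.Im z ->
  f x @[x --> F] --> z.
Proof.
move=> fr fi; apply/(@cvgrPdist_lt _ R[i]^o) => e e0.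
have [e' e'0 ->] : exists2 e', 0 < e' & e = e'%:C.
  case: e e0 => a b; rewrite ltcE /= => /andP[/eqP b0 a0].
  by exists a; rewrite // b0.
have e2 : 0 < e' / 2 by rewrite divr_gt0.
move/cvgrPdist_lt: fr => /(_ _ e2) fr; move/cvgrPdist_lt: fi => /(_ _ e2) fi.
near=> x.
have hr : `|complex.Re z - complex.Re (f x)| < e' / 2 by near: x.
have hi : `|complex.Im z - complex.Im (f x)| < e' / 2 by near: x.
move: hr hi; case: (f x) => a b; case: (z) => c d /= hr hi.
rewrite (_ : _ - _ = (c - a)%:C + (d - b)%:C * 'i); last by simpc.
apply: le_lt_trans (ler_normD _ _) _; rewrite normrM.
rewrite !normc_def /= !expr0n /= !addr0 !add0r !expr1n !sqrtr1 !sqrtr_sqr mulr1.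
by rewrite -rmorphD ltcR; lra.
Unshelve. all: by end_near. Qed.

Lemma cvg_Re (T : Type) (F : set_system T) (FF : Filter F)
    (f : T -> R[i]) (z : R[i]) :
  f x @[x --> F] --> z -> complex.Re (f x) @[x --> F] --> complex.Re z.
Proof.
move=> /(@cvgrPdist_lt _ R[i]^o) fz; apply/cvgrPdist_lt => e e0.
have e0' : 0 < e%:C by rewrite ltcR.
apply: filterS (fz _ e0') => x; rewrite -ltcR; apply: le_lt_trans.
by rewrite -raddfB; exact: normc_ge_Re.
Qed.

Lemma cvg_Im (T : Type) (F : set_system T) (FF : Filter F)
    (f : T -> R[i]) (z : R[i]) :
  f x @[x --> F] --> z -> complex.Im (f x) @[x --> F] --> complex.Im z.
Proof.
move=> fz.
rewrite (_ : (fun x => complex.Im (f x)) = fun x => - complex.Re (f x * 'i)).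
  rewrite (_ : complex.Im z = - complex.Re (z * 'i)); last by rewrite ReiNIm opprK.
  have fzi : f x * 'i @[x --> F] --> z * 'i by apply: cvgM fz _; exact: cvg_cst.
  by apply: cvgN; exact: cvg_Re fzi.
by apply/funext => x; rewrite ReiNIm opprK.
Qed.

Lemma continuous_expi : continuous (@expi R).
Proof.
by move=> t; apply: cvg_complex => /=; [exact: continuous_cos|exact: continuous_sin].
Qed.

Lemma compact_circle : compact [set z : R[i] | `|z| = 1].
Proof.
rewrite (_ : [set _ | _] = @expi R @` `[- pi, pi]).
  apply: continuous_compact; last exact: segment_compact.
  exact/continuous_subspaceT/continuous_expi.
apply/seteqP; split => [z /expi_surj[t tpi ->]|_ [t _ <-]]; last exact: norm_expi.
by exists t => //=; rewrite in_itv /= -ler_norml.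
Qed.

Lemma compact_torus r : compact (torus R r).
Proof.
by apply: (@rV_compact _ r (fun=> [set z : R[i] | `|z| = 1])) => _; exact: compact_circle.
Qed.

Lemma hausdorff_rV r : hausdorff_space 'rV[R[i]]_r.
Proof.
move=> p q pq; apply/rowP => i.
apply: (@norm_hausdorff _ R[i]^o) => A B pA qB.
have cc (z : 'rV[R[i]]_r) (V : set R[i]) : nbhs (z 0 i) V -> nbhs z [set w | V (w 0 i)].
  exact: (@coord_continuous R[i] 1 r 0 i z).
have [w [wA wB]] := pq _ _ (cc _ _ pA) (cc _ _ qB).
by exists (w 0 i).
Qed.

Lemma cvg_coord (T : Type) (F : set_system T) (FF : Filter F) m n
    (f : T -> 'M[R[i]]_(m, n)) (l : 'M[R[i]]_(m, n)) i j :
  f x @[x --> F] --> l -> f x i j @[x --> F] --> l i j.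
Proof. by move=> fl; exact: (cvg_comp _ _ fl (@coord_continuous _ m n i j l)). Qed.

Lemma cvg_expr (T : Type) (F : set_system T) (FF : Filter F)
    (f : T -> R[i]) (l : R[i]) k :
  f x @[x --> F] --> l -> f x ^+ k @[x --> F] --> l ^+ k.
Proof.
move=> fl; elim: k => [|k IH]; first by rewrite expr0; exact: cvg_cst.
by rewrite exprS; under eq_fun do rewrite exprS; exact: (cvgM fl IH).
Qed.

Lemma cvg_exprz (T : Type) (F : set_system T) (FF : Filter F)
    (f : T -> R[i]) (l : R[i]) (k : int) : l != 0 ->
  f x @[x --> F] --> l -> f x ^ k @[x --> F] --> l ^ k.
Proof.
move=> l0 fl; case: k => k; first exact: cvg_expr.
rewrite NegzE -exprnN; under eq_fun do rewrite -exprnN.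
have lk0 : l ^+ k.+1 != 0 by rewrite expf_neq0.
have fk := @cvg_expr _ _ FF _ _ k.+1 fl.
exact: (@cvgV _ _ _ FF _ _ lk0 fk).
Qed.

Lemma cvg_prod (T I : Type) (F : set_system T) (FF : Filter F) (s : seq I)
    (f : I -> T -> R[i]) (l : I -> R[i]) :
  (forall i, f i x @[x --> F] --> l i) ->
  \prod_(i <- s) f i x @[x --> F] --> \prod_(i <- s) l i.
Proof.
move=> fl; elim: s => [|i s IH].
  by rewrite big_nil; under eq_fun do rewrite big_nil; exact: cvg_cst.
by rewrite big_cons; under eq_fun do rewrite big_cons; exact: (cvgM (fl i) IH).
Qed.

Lemma cvg_tmul (T : Type) (F : set_system T) (FF : Filter F) r
    (f g : T -> 'rV[R[i]]_r) (z w : 'rV[R[i]]_r) :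
  f x @[x --> F] --> z -> g x @[x --> F] --> w ->
  tmul (f x) (g x) @[x --> F] --> tmul z w.
Proof.
move=> fz gw; apply: cvg_mx_coord => i j; rewrite mxE.
under eq_fun do rewrite mxE.
by apply: cvgM; exact: cvg_coord.
Qed.

Lemma continuous_tmul r (z : 'rV[R[i]]_r) : continuous (tmul z).
Proof.
by move=> w; apply: (@cvg_tmul _ (nbhs w) _ r (fun=> z)); [exact: cvg_cst|exact: cvg_id].
Qed.

End Topology.

(** * The line is dense in the subgroup H *)

Section Group.
Variable R : realType.

Lemma tmulA r : associative (@tmul R r).
Proof. by move=> x y z; apply/rowP => i; rewrite !mxE mulrA. Qed.

Lemma tmulC r : commutative (@tmul R r).
Proof. by move=> x y; apply/rowP => i; rewrite !mxE mulrC. Qed.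

Lemma tmul1 r (z : 'rV[R[i]]_r) : tmul z (const_mx 1) = z.
Proof. by apply/rowP => i; rewrite !mxE mulr1. Qed.

Lemma torus_tmul r (z w : 'rV[R[i]]_r) :
  torus R r z -> torus R r w -> torus R r (tmul z w).
Proof. by move=> hz hw i; rewrite mxE normrM hz hw mulr1. Qed.

Lemma one_paramD r (theta : 'I_r -> R) s t :
  one_param theta (s + t) = tmul (one_param theta s) (one_param theta t).
Proof. by apply/rowP => i; rewrite !mxE mulrDr expiD. Qed.

Lemma one_param0 r (theta : 'I_r -> R) : one_param theta 0 = const_mx 1.
Proof. by apply/rowP => i; rewrite !mxE mulr0 expi0. Qed.

Lemma one_paramK r (theta : 'I_r -> R) s :
  cancel (tmul (one_param theta s)) (tmul (one_param theta (- s))).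
Proof.
by move=> z; rewrite tmulA -one_paramD addNr one_param0 tmulC tmul1.
Qed.

Lemma torus_one_param r (theta : 'I_r -> R) s : torus R r (one_param theta s).
Proof. by move=> i; rewrite mxE norm_expi. Qed.

Lemma continuous_one_param r (theta : 'I_r -> R) : continuous (one_param theta).
Proof.
move=> y; apply: (@cvg_mx_coord _ (nbhs y)) => i j; rewrite mxE.
under eq_fun do rewrite mxE.
apply: (@cvg_comp _ _ _ (fun x => theta j * x) (@expi R)); last exact: continuous_expi.
exact: mulrl_continuous.
Qed.

Definition Hmap m n (b : 'M[rat]_(m, n)) (z : 'rV[R[i]]_m) : 'rV[R[i]]_(m + n) :=
  row_mx (\row_k z 0 k ^+ lcm_denom b)
         (\row_j \prod_(k < m) z 0 k ^ cleared_coef b k j).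

Section Hmap.
Variables (m n : nat) (b : 'M[rat]_(m, n)).

Lemma HsubE : Hsub R b = Hmap b @` torus R m.
Proof. by []. Qed.

Lemma Hmap_lshift z k : Hmap b z 0 (lshift n k) = z 0 k ^+ lcm_denom b.
Proof. by rewrite row_mxEl mxE. Qed.

Lemma Hmap_rshift z j :
  Hmap b z 0 (rshift m j) = \prod_(k < m) z 0 k ^ cleared_coef b k j.
Proof. by rewrite row_mxEr mxE. Qed.

Lemma HmapM (z w : 'rV[R[i]]_m) : Hmap b (tmul z w) = tmul (Hmap b z) (Hmap b w).
Proof.
apply/rowP => i; rewrite [RHS]mxE; case: (split_ordP i) => j ->.
  by rewrite !Hmap_lshift mxE exprMn.
rewrite !Hmap_rshift -big_split /=.
by apply: eq_bigr => k _; rewrite mxE expfzMl.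
Qed.

Lemma Hmap1 : Hmap b (const_mx 1) = const_mx 1.
Proof.
apply/rowP => i; rewrite [RHS]mxE; case: (split_ordP i) => j ->.
  by rewrite Hmap_lshift mxE expr1n.
by rewrite Hmap_rshift big1 // => k _; rewrite mxE exp1rz.
Qed.

Lemma torus_Hmap z : torus R m z -> torus R (m + n) (Hmap b z).
Proof.
move=> hz i; case: (split_ordP i) => j ->.
  by rewrite Hmap_lshift normrX hz expr1n.
rewrite Hmap_rshift normr_prod big1 // => k _; case: (cleared_coef b k j) => e.
  by rewrite normrX hz expr1n.
by rewrite NegzE -exprnN normfV normrX hz expr1n invr1.
Qed.

Lemma Hsub_torus : Hsub R b `<=` torus R (m + n).
Proof. by move=> _ [z hz <-]; exact: torus_Hmap. Qed.

Lemma cvg_Hmap (T : Type) (F : set_system T) (FF : Filter F)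
    (f : T -> 'rV[R[i]]_m) (z : 'rV[R[i]]_m) :
  torus R m z -> f x @[x --> F] --> z -> Hmap b (f x) @[x --> F] --> Hmap b z.
Proof.
move=> hz fz; apply: cvg_mx_coord => i j; rewrite ord1; case: (split_ordP j) => k ->.
  rewrite Hmap_lshift; under eq_fun do rewrite Hmap_lshift.
  by apply: cvg_expr; exact: cvg_coord.
rewrite Hmap_rshift; under eq_fun do rewrite Hmap_rshift.
apply: (@cvg_prod _ _ _ F FF _ (fun l x => f x 0 l ^ cleared_coef b l k)) => l.
apply: cvg_exprz; last exact: cvg_coord.
by rewrite -normr_eq0 hz oner_eq0.
Qed.

Lemma continuous_Hmap z : torus R m z -> {for z, continuous (Hmap b)}.
Proof. by move=> hz; apply: (@cvg_Hmap _ (nbhs z) _ id z hz); exact: cvg_id. Qed.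

Lemma compact_Hsub : compact (Hsub R b).
Proof.
rewrite HsubE; apply: continuous_compact; last exact: compact_torus.
rewrite continuous_subspace_in => z; rewrite inE => hz.
by apply: continuous_subspaceT_for => //; exact: continuous_Hmap.
Qed.

Lemma closed_Hsub : closed (Hsub R b).
Proof. by apply: compact_closed; [exact: hausdorff_rV|exact: compact_Hsub]. Qed.

Lemma Hsub_tmul z w : Hsub R b z -> Hsub R b w -> Hsub R b (tmul z w).
Proof.
move=> [z' hz' <-] [w' hw' <-]; rewrite -/(Hmap b z') -/(Hmap b w') -HmapM.
by exists (tmul z' w') => //; exact: torus_tmul.
Qed.

Lemma lcm_denom_gt0 : (0 < lcm_denom b)%N.
Proof.
rewrite /lcm_denom; elim/big_ind: _ => // [x y|k _]; first by rewrite lcmn_gt0 => -> ->.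
elim/big_ind: _ => // [x y|j _]; first by rewrite lcmn_gt0 => -> ->.
by rewrite absz_gt0 denq_neq0.
Qed.

Variable theta : 'I_(m + n) -> R.
Hypothesis theta_dep : forall j : 'I_n,
  theta (rshift m j) = \sum_(k < m) ratr (b k j) * theta (lshift n k).

Let w (k : 'I_m) := theta (lshift n k) / (lcm_denom b)%:R.

Let d0 : (lcm_denom b)%:R != 0 :> R.
Proof. by rewrite pnatr_eq0 -lt0n lcm_denom_gt0. Qed.

(** Both [d * w k = theta k] and [sum_k h_kj * w k = theta (m + j)] hold because
    [h_kj = d * b_kj]: clearing denominators is what makes the powers integral. *)
Lemma Hmap_one_param s : Hmap b (one_param w s) = one_param theta s.
Proof.
apply/rowP => i; rewrite [RHS]mxE; case: (split_ordP i) => j ->.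
  by rewrite Hmap_lshift mxE -expiMn; congr expi; rewrite /w; field.
rewrite Hmap_rshift theta_dep mulr_suml expi_sum; apply: eq_bigr => k _.
rewrite mxE -expiMz; congr expi.
have := congr1 (@ratr R) (cleared_coefE b k j).
rewrite ratr_int rmorphM /= ratr_nat => ->.
by rewrite /w; field.
Qed.

Lemma Hsub_one_param s : Hsub R b (one_param theta s).
Proof.
by rewrite -Hmap_one_param; exists (one_param w s) => //; exact: torus_one_param.
Qed.

Hypothesis theta_free : rat_free (fun k : 'I_m => theta (lshift n k)).

Lemma w_free : rat_free w.
Proof.
move=> a aw; apply: theta_free; apply: (mulIf (invr_neq0 d0)).
rewrite mul0r mulr_suml -[RHS]aw; apply: eq_bigr => k _; by rewrite /w mulrA.
Qed.

(** Write [p = Hmap z].  Kronecker's theorem brings the line of frequencies [w]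
    close to [z], and the continuous homomorphism [Hmap] carries the quotient,
    close to 1, to the quotient of [p] by a point of the line. *)
Lemma one_param_dense p (U : set 'rV[R[i]]_(m + n)) :
  Hsub R b p -> nbhs (const_mx 1 : 'rV[R[i]]_(m + n)) U ->
  exists2 s, 0 <= s & U (tmul (one_param theta (- s)) p).
Proof.
move=> [z hz <-] U1; rewrite -/(Hmap b z).
have t1 : torus R m (const_mx 1) by move=> i; rewrite mxE normr1.
have := @cvg_Hmap _ _ (nbhs_filter (const_mx 1 : 'rV[R[i]]_m)) id _ t1 (@cvg_id _ _).
rewrite Hmap1 => /(_ _ U1).
move=> /(@nbhs_ballP _ 'rV[R[i]^o]_m)[e /= e0 eU].
have [e' e'0 eE] : exists2 e', 0 < e' & e = e'%:C.
  case: e e0 {eU} => a c; rewrite ltcE /= => /andP[/eqP b0 a0].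
  by exists a; rewrite // b0.
have [s s0 hs] := kronecker w_free hz e'0.
exists s => //; rewrite -Hmap_one_param -HmapM; apply: eU; split => // i k.
rewrite ord1 /ball /= !mxE mulrN expiN eE; apply: le_lt_trans (hs k).
by rewrite -[X in X - _](mulVf (expi_neq0 (w k * s))) -mulrBr normrM normfV
  norm_expi invr1 mul1r.
Qed.

End Hmap.
End Group.

(** * Integrals over finite partitions, and averages of translates *)

Section Cells.
Context (R : realType) (d : measure_display) (T : measurableType d).
Variable mu : {measure set T -> \bar R}.

Lemma Rintegral_near_cst (D : set T) (w c e : R) (g : T -> R) :
  measurable D -> mu D = w%:E -> mu.-integrable D (EFin \o g) ->
  (forall z, D z -> `|g z - c| <= e) ->
  `|\int[mu]_(z in D) g z - w * c| <= w * e.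
Proof.
move=> mD muD ig gc.
have ic (r : R) : mu.-integrable D (EFin \o cst r).
  apply: measurable_bounded_integrable => //; first by rewrite muD ltry.
  by exists `|r|; split=> // M rM y _; exact: ltW.
have -> : \int[mu]_(z in D) g z - w * c = \int[mu]_(z in D) (g z - c).
  by rewrite (RintegralB mD ig (ic c)) Rintegral_cst // muD /= mulrC.
have igc : mu.-integrable D (EFin \o (fun z => g z - c)).
  exact: (integrableB mD ig (ic c)).
apply: le_trans (le_normr_Rintegral mD igc) _.
have -> : w * e = \int[mu]_(z in D) e by rewrite Rintegral_cst // muD /= mulrC.
exact: (le_Rintegral mD (integrable_norm igc) (ic e) gc).
Qed.

Lemma Rintegral_cells (D : nat -> set T) (N : nat) (w c : nat -> R) (e : R) (g : T -> R) :
  (forall i, measurable (D i)) -> trivIset setT D ->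
  (forall i, mu (D i) = (w i)%:E) ->
  mu.-integrable (\big[setU/set0]_(i < N) D i) (EFin \o g) ->
  (forall i z, (i < N)%N -> D i z -> `|g z - c i| <= e) ->
  `|\int[mu]_(z in \big[setU/set0]_(i < N) D i) g z - \sum_(i < N) w i * c i|
    <= (\sum_(i < N) w i) * e.
Proof.
move=> mD tD muD; elim: N => [|N IH] ig gc.
  by rewrite !big_ord0 Rintegral_set0 subrr normr0 mul0r.
have mU : measurable (\big[setU/set0]_(i < N) D i) by exact: bigsetU_measurable.
move: ig; rewrite big_ord_recr /= => ig.
have igN : mu.-integrable (D N) (EFin \o g).
  by apply: integrableS ig => //; exact: measurableU.
have igU : mu.-integrable (\big[setU/set0]_(i < N) D i) (EFin \o g).
  by apply: integrableS ig => //; exact: measurableU.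
rewrite Rintegral_setU //; last first.
  apply/disj_setPS => z [+ zN]; rewrite -bigcup_mkord => -[i /= iN zi].
  have := tD i N I I; move=> /(_ (ex_intro _ z (conj zi zN))) iE.
  by rewrite iE ltnn in iN.
rewrite 2!big_ord_recr /= opprD addrACA mulrDl (le_trans (ler_normD _ _)) //.
apply: lerD; first by apply: IH => // i z iN; apply: gc; exact: ltnW.
by apply: Rintegral_near_cst => // z; exact: gc.
Qed.

End Cells.

Section Averages.
Variable R : realType.
Implicit Types phi : R -> R.
Local Notation leb := (@lebesgue_measure R).

Lemma integrable_itv phi a b : continuous phi ->
  leb.-integrable `[a, b] (EFin \o phi).
Proof.
move=> cphi; apply: continuous_compact_integrable; first exact: segment_compact.
exact: continuous_subspaceT.
Qed.

Lemma lebesgue_itv (a b : R) : a <= b -> leb `[a, b] = (b - a)%:E.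
Proof.
rewrite le_eqVlt => /predU1P[->|ab]; rewrite lebesgue_measure_itv /= lte_fin.
  by rewrite ltxx subrr.
by rewrite ab -EFinB.
Qed.

Lemma Rintegral_itv_shift phi s X : continuous phi -> 0 <= X ->
  \int[leb]_(y in `[0, X]) phi (y + s) = \int[leb]_(y in `[s, X + s]) phi y.
Proof.
move=> cphi X0; pose F (y : R) := y + s.
have dF y : is_derive y (1 : R) F 1.
  by rewrite -[1 in X in is_derive _ _ _ X]addr0; exact: is_deriveD.
have F' : (F^`())%classic = fun=> 1.
  by apply/funext => y; rewrite derive1E derive_val.
have := @integration_by_substitution_increasing R F phi 0 X X0.
rewrite F' /F add0r => H.
rewrite /Rintegral H.
- congr fine; apply: eq_integral => y _ /=.
  by rewrite /= mulr1.
- by move=> x y _ _; rewrite ltrD2r.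
- by move=> x _; exact: cvg_cst.
- exact: is_cvg_cst.
- exact: is_cvg_cst.
- have cF : continuous F by move=> y; apply: cvgD; [exact: cvg_id|exact: cvg_cst].
  split.
  + by move=> y _; apply: ex_derive.
  + exact/cvg_at_right_filter/cF.
  + exact/cvg_at_left_filter/cF.
- exact: continuous_subspaceT.
Qed.

(** The intervals [0, X] and [s, X + s] differ by two intervals of length [s]. *)
Lemma Rintegral_shift_close phi M s X : continuous phi ->
  (forall y, `|phi y| <= M) -> 0 <= s -> 0 <= X ->
  `|\int[leb]_(y in `[0, X]) phi (y + s) - \int[leb]_(y in `[0, X]) phi y|
    <= 2 * M * s.
Proof.
move=> cphi bphi s0 X0; rewrite Rintegral_itv_shift //.
have i a b := @integrable_itv phi a b cphi.
have bnd a : `|\int[leb]_(y in `[a, a + s]) phi y| <= s * M.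
  have := @Rintegral_near_cst _ _ _ leb `[a, a + s] s 0 M phi.
  rewrite mulr0 subr0; apply => //; last by move=> z _; rewrite subr0.
  by apply: etrans (lebesgue_itv _) _; rewrite ?lerDl // addrAC subrr add0r.
have split a b c : a <= b -> b <= c -> \int[leb]_(y in `[a, c]) phi y =
    \int[leb]_(y in `[a, b]) phi y + \int[leb]_(y in `[b, c]) phi y.
  move=> ab bc.
  have := @Rintegral_itvB R phi (BLeft a) (BRight c) b (i a c).
  rewrite !bnd_simp => /(_ ab bc) E.
  rewrite -(@Rintegral_itv_obnd_cbnd R b (BRight c)); last first.
    by apply: integrableS (i b c) => //; exact: subset_itv_oc_cc.
  by rewrite -E addrC subrK.
have e1 := @split 0 s (X + s) s0 ltac:(by rewrite lerDr).
have e2 := @split 0 X (X + s) X0 ltac:(by rewrite lerDl).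
have -> : \int[leb]_(y in `[s, X + s]) phi y - \int[leb]_(y in `[0, X]) phi y =
  \int[leb]_(y in `[X, X + s]) phi y - \int[leb]_(y in `[0, 0 + s]) phi y.
  rewrite add0r; lra.
rewrite (le_trans (ler_normB _ _)) // -mulrA mulr_natl mulr2n [M * s]mulrC.
by apply: lerD.
Qed.

Lemma continuous_translate phi s :
  continuous phi -> continuous (fun y => phi (y + s)).
Proof.
move=> cphi y; apply: (@cvg_comp _ _ _ (fun y => y + s) phi); last exact: cphi.
exact: (cvgD cvg_id (cvg_cst s)).
Qed.

Lemma integrable_shift phi (w s : R) X : continuous phi ->
  leb.-integrable `[0, X] (EFin \o (fun y => w * phi (y + s))).
Proof.
move=> cphi; apply: integrable_itv => y.
apply: (@cvgM _ _ (nbhs y) _ (fun=> w) (fun y => phi (y + s))).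
  exact: cvg_cst.
exact: continuous_translate.
Qed.

Lemma integrable_sum_shift phi N (w s : nat -> R) X : continuous phi ->
  leb.-integrable `[0, X] (EFin \o (fun y => \sum_(i < N) w i * phi (y + s i))).
Proof.
move=> cphi.
rewrite (_ : EFin \o _ = fun y => (\sum_(i < N) (w i * phi (y + s i))%:E)%E).
  by apply: integrable_sum => // i _; exact: integrable_shift.
by apply/funext => y; rewrite /= sumEFin.
Qed.

Lemma Rintegral_sum_shift phi N (w s : nat -> R) X : continuous phi ->
  \int[leb]_(y in `[0, X]) (\sum_(i < N) w i * phi (y + s i)) =
  \sum_(i < N) w i * \int[leb]_(y in `[0, X]) phi (y + s i).
Proof.
move=> cphi; elim: N => [|N IH].
  rewrite (_ : (fun y => _) = cst 0); last first.
    by apply/funext => y; rewrite big_ord0.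
  by rewrite Rintegral_cst // mul0r big_ord0.
rewrite (_ : (fun y => _) = fun y => \sum_(i < N) w i * phi (y + s i)
  + w N * phi (y + s N)); last by apply/funext => y; rewrite big_ord_recr.
have iN := @integrable_itv _ 0 X (@continuous_translate phi (s N) cphi).
rewrite (@RintegralD _ _ R leb _ _ _ (measurable_itv _)
  (@integrable_sum_shift phi N w s X cphi)
  (@integrable_shift phi (w N) (s N) X cphi)).
by rewrite IH RintegralZl // big_ord_recr.
Qed.

End Averages.

(** * Continuous functions on the torus *)

Section TorusFunctions.
Variables (R : realType) (r : nat) (g : 'rV[R[i]]_r -> R).
Hypothesis g_cont : {within torus R r, continuous g}.

(** Uniform continuity with respect to the group structure: one neighbourhood of
    the unit serves all points, by compactness of the torus. *)
Lemma translation_unif_continuous e : 0 < e ->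
  \forall u \near (const_mx 1 : 'rV[R[i]]_r), torus R r u ->
    forall z, torus R r z -> `|g (tmul z u) - g z| < e.
Proof.
move=> e0.
have /compact_near_coveringP/near_covering_withinP H := @compact_torus R r.
suff hz : forall z, torus R r z -> \forall z' \near z &
    u \near (const_mx 1 : 'rV[R[i]]_r), torus R r z' -> torus R r u ->
      `|g (tmul z' u) - g z'| < e.
  apply: filterS (H _ _ (fun u z => torus R r u -> `|g (tmul z u) - g z| < e)
    (nbhs_filter _) hz) => u hu Tu z Tz.
  exact: hu.
move=> z Tz.
have e2 : 0 < e / 2 by rewrite divr_gt0.
have gz : \forall w \near z, torus R r w -> `|g z - g w| < e / 2.
  move/subspace_continuousP: g_cont => /(_ z Tz) /cvgrPdist_lt /(_ _ e2).
  by rewrite /within.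
have hm : tmul p.1 p.2 @[p --> (z, const_mx 1 : 'rV[R[i]]_r)] --> z.
  rewrite -[X in _ --> X]tmul1.
  exact: (@cvg_tmul R _ (filter_prod (nbhs z) (nbhs (const_mx 1 : 'rV[R[i]]_r))) _ r
    fst snd z (const_mx 1) cvg_fst cvg_snd).
have hm' := hm _ gz.
have hf : \forall p \near (z, const_mx 1 : 'rV[R[i]]_r),
    torus R r p.1 -> `|g z - g p.1| < e / 2.
  exact: (@cvg_fst _ _ _ _ _ _ gz).
apply: (@filterS2 _ (filter_prod (nbhs z) (nbhs (const_mx 1 : 'rV[R[i]]_r))) _
  _ _ _ _ hm' hf) => -[z' u] /= h1 h2 Tz' Tu.
have := h1 (torus_tmul Tz' Tu); have := h2 Tz'.
rewrite !ltr_norml; lra.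
Qed.

Lemma torus_bounded : exists M, forall z, torus R r z -> `|g z| <= M.
Proof.
have := compact_bounded (continuous_compact g_cont (@compact_torus R r)).
move=> [M [_ HM]]; exists (M + 1) => z Tz.
by apply: HM; [rewrite ltrDl|exists z].
Qed.

Lemma continuous_one_param_comp theta : continuous (g \o one_param theta).
Proof.
move=> y; apply/cvgrPdist_lt => e e0.
move/subspace_continuousP: g_cont => /(_ _ (torus_one_param theta y)).
move=> /cvgrPdist_lt /(_ _ e0) H.
have := @continuous_one_param R r theta y _ H.
by apply: (@filterS _ (nbhs y)) => x /=; apply; exact: torus_one_param.
Qed.

Lemma closed_borel (A : set 'rV[R[i]]_r) :
  closed A -> measurable (A : set (borel_rV R r)).
Proof.
move=> cA; rewrite -[A]setCK; apply: measurableC.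
by apply: sub_sigma_algebra; exact: closed_openC.
Qed.

Lemma measurable_fun_torus (H : set 'rV[R[i]]_r) : H `<=` torus R r -> closed H ->
  measurable_fun (H : set (borel_rV R r)) g.
Proof.
move=> HT cH mH.
apply: (measurability _ (measurable_realfun.RGenOInfty.measurableE R)); last exact: mH.
move=> _ [_ [x ->] <-].
have oI : open (`]x, +oo[%classic : set R) by exact: interval_open.
have /continuousP/(_ _ oI) := continuous_subspaceW HT g_cont.
move=> /open_subspaceP[V oV VE].
rewrite setIC -VE; apply: measurableI; last exact: mH.
exact: sub_sigma_algebra.
Qed.

Lemma measurable_tmul z :
  measurable_fun [set: borel_rV R r] (tmul z : borel_rV R r -> borel_rV R r).
Proof.
apply: measurability => // _ [A oA <-]; rewrite setTI; apply: sub_sigma_algebra.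
by apply: open_comp => // w _; exact: continuous_tmul.
Qed.

End TorusFunctions.

(** * Time averages and the Haar integral *)

Section Equidistribution.
Variables (R : realType) (m n : nat) (theta : 'I_(m + n) -> R).
Variable b : 'M[rat]_(m, n).
Hypothesis theta_free : rat_free (fun k : 'I_m => theta (lshift n k)).
Hypothesis theta_dep : forall j : 'I_n,
  theta (rshift m j) = \sum_(k < m) ratr (b k j) * theta (lshift n k).
Local Notation H := (Hsub R b).
Local Notation gamma := (one_param theta).
Local Notation T := (torus R (m + n)).

Lemma Hsub_translate y z : H (tmul (gamma y) z) <-> H z.
Proof.
split=> Hz; last by apply: Hsub_tmul => //; exact: Hsub_one_param.
rewrite -(one_paramK theta y z); apply: Hsub_tmul => //.
exact: Hsub_one_param.
Qed.

(** By density every point of [H] lies in some translate of the interior of [U]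
    by a point of the half-line [s >= 0], and [H] is compact. *)
Lemma finite_net (U : set 'rV[R[i]]_(m + n)) :
  nbhs (const_mx 1 : 'rV[R[i]]_(m + n)) U ->
  exists (N : nat) (s : nat -> R), (forall i, 0 <= s i) /\
    forall z, H z -> exists2 i, (i < N)%N & U (tmul (gamma (- s i)) z).
Proof.
move=> U1.
pose f (s : R) := [set z | (U° : set 'rV[R[i]]_(m + n)) (tmul (gamma (- s)) z)].
have := @compact_Hsub R m n b; rewrite compact_cover.
move=> /(_ R [set s | 0 <= s] f)[].
- move=> s _; apply: open_comp; last exact: open_interior.
  by move=> w _; exact: continuous_tmul.
- move=> z Hz; have U1' : nbhs (const_mx 1 : 'rV[R[i]]_(m + n)) U°.
    by apply: open_nbhs_nbhs; split; [exact: open_interior|exact: U1].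
  have [s s0 Us] := one_param_dense theta_dep theta_free Hz U1'.
  by exists s.
move=> D D0 HD; pose l := finmap.enum_fset D.
(* The default value 0 keeps [s i >= 0] beyond the end of the list. *)
exists (size l), (nth 0 l); split.
  move=> i; have [il|il] := ltnP i (size l); last by rewrite nth_default.
  by have := D0 _ (mem_nth 0 il); rewrite inE.
move=> z /HD[s sD /interior_subset Us].
exists (index s l); first by rewrite index_mem.
by rewrite nth_index.
Qed.

Variable mu : {measure set (borel_rV R (m + n)) -> \bar R}.
Hypothesis mu_haar : normalized_haar H mu.

Let mH : measurable (H : set (borel_rV R (m + n))).
Proof. by apply: closed_borel; exact: closed_Hsub. Qed.

(** The preimage is the translate of [A] by [gamma y]; it is written as a preimage
    because preimages of Borel sets are Borel. *)
Lemma haar_translate y (A : set (borel_rV R (m + n))) : measurable A -> A `<=` H ->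
  mu (tmul (gamma (- y)) @^-1` A) = mu A.
Proof.
move=> mA AH; have [_ _ inv] := mu_haar.
rewrite -(inv (gamma y) A (Hsub_one_param theta_dep y) mA AH); congr (mu _).
apply/seteqP; split => [z /= Az|_ [a Aa <-]] /=; last by rewrite one_paramK.
exists (tmul (gamma (- y)) z) => //.
by have := one_paramK theta (- y) z; rewrite opprK.
Qed.

Section Function.
Variable g : 'rV[R[i]]_(m + n) -> R.
Hypothesis g_cont : {within T, continuous g}.
Local Notation L := (\int[mu]_(z in H) g z).

Lemma integrable_haar : mu.-integrable (H : set (borel_rV R (m + n))) (EFin \o g).
Proof.
have [M gM] := torus_bounded g_cont.
apply: measurable_bounded_integrable => //.
- by have [-> _ _] := mu_haar; rewrite ltry.
- apply: measurable_fun_torus => //; [exact: Hsub_torus|exact: closed_Hsub].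
- exists M; split; first exact: num_real.
  by move=> x Mx z /Hsub_torus /gM /le_trans; apply; exact: ltW.
Qed.

(** The heart of the proof: an [e]-approximation of the Haar integral by point
    evaluations along the line, uniform over all translations of the line.  The
    weights are the measures of the cells [C i] of a finite Borel partition of
    [H] subordinate to a net.  For a given [y] one integrates over the partition
    translated by [gamma y], whose cells have the same measures by invariance. *)
Lemma haar_mean_approx e : 0 < e -> exists (N : nat) (w s : nat -> R),
  [/\ forall i, 0 <= w i, \sum_(i < N) w i = 1, forall i, 0 <= s i &
  forall y, `|L - \sum_(i < N) w i * g (gamma (y + s i))| <= e].
Proof.
move=> e0.
pose U := [set u | T u -> forall z, T z -> `|g (tmul z u) - g z| < e].
have U1 : nbhs (const_mx 1 : 'rV[R[i]]_(m + n)) U.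
  exact: translation_unif_continuous.
have U1' : nbhs (const_mx 1 : 'rV[R[i]]_(m + n)) U°.
  by apply: open_nbhs_nbhs; split; [exact: open_interior|exact: U1].
have [N [s [s0 net]]] := finite_net U1'.
pose B (i : nat) : set (borel_rV R (m + n)) :=
  H `&` [set z | (U° : set 'rV[R[i]]_(m + n)) (tmul (gamma (- s i)) z)].
have mB i : measurable (B i).
  apply: measurableI => //; apply: sub_sigma_algebra.
  apply: open_comp; last exact: open_interior.
  by move=> w _; exact: continuous_tmul.
pose C := seqDU B.
have mC i : measurable (C i) by exact: seqDU_measurable.
have CB i : C i `<=` B i by exact: subset_seqDU.
have CH i : C i `<=` H by move=> z /CB[].
have muH : mu H = 1%E by case: mu_haar.
pose w i := fine (mu (C i)).
have muC i : mu (C i) = (w i)%:E.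
  rewrite fineK // ge0_fin_numE //.
  apply: (@le_lt_trans _ _ 1%E); last by rewrite ltry.
  by rewrite -muH; apply: le_measure; rewrite ?inE //.
have UC : \big[setU/set0]_(i < N) C i = H.
  rewrite -bigsetU_seqDU -bigcup_mkord; apply/seteqP; split=> [z [i _ []]//|z Hz].
  by have [i iN Uz] := net z Hz; exists i.
pose D y i := tmul (gamma (- y)) @^-1` C i : set (borel_rV R (m + n)).
have mD y i : measurable (D y i).
  by have := measurable_tmul (gamma (- y)) measurableT (mC i); rewrite setTI.
have tD y : trivIset setT (D y).
  move=> i j _ _ [z [zi zj]]; apply: (@trivIset_seqDU _ B) => //.
  by exists (tmul (gamma (- y)) z).
have muD y i : mu (D y i) = (w i)%:E by rewrite haar_translate.
have UD y : \big[setU/set0]_(i < N) D y i = H.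
  rewrite -bigcup_mkord -preimage_bigcup bigcup_mkord UC.
  by apply/seteqP; split => z /= /Hsub_translate.
have w1 : \sum_(i < N) w i = 1.
  have mU : measurable (\big[setU/set0]_(i < N) C i) by exact: bigsetU_measurable.
  have muU : mu (\big[setU/set0]_(i < N) C i) = 1%E by rewrite -muH; congr (mu _).
  have := etrans (esym muU)
    (@measure_semi_additive _ _ _ mu C N mC (@trivIset_seqDU _ B) mU).
  rewrite (eq_bigr (fun i : 'I_N => (w i)%:E)); last by move=> i _; exact: muC.
  by rewrite sumEFin => -[<-].
exists N, w, s; split=> //; first by move=> i; rewrite fine_ge0.
move=> y.
have := @Rintegral_cells _ _ _ mu (D y) N w (fun i => g (gamma (y + s i))) e g
  (mD y) (@tD y) (muD y).
rewrite UD w1 mul1r; apply; first exact: integrable_haar.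
move=> i z iN Dz; have [Hz Uz] := CB _ _ Dz.
pose u := tmul (gamma (- s i)) (tmul (gamma (- y)) z).
have zE : z = tmul (gamma (y + s i)) u.
  rewrite one_paramD -tmulA /u.
  have := one_paramK theta (- s i) (tmul (gamma (- y)) z); rewrite opprK => ->.
  by have := one_paramK theta (- y) z; rewrite opprK.
have Tu : T u.
  apply: torus_tmul; first exact: torus_one_param.
  by apply: (@Hsub_torus R m n b).
rewrite [in g z]zE; apply: ltW.
have : U u by exact: (@interior_subset _ U).
by move=> /(_ Tu _ (torus_one_param theta (y + s i))).
Qed.

(** Integrate [haar_mean_approx] over [y] in [0, X].  Replacing each integral of
    [phi (y + s i)] by that of [phi] costs at most [S] in total, independently of
    [X], which is negligible after division by [X]. *)
Lemma equidistribution_real :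
  X^-1 * \int[lebesgue_measure]_(y in `[0, X]) g (gamma y) @[X --> +oo] --> L.
Proof.
have cphi := @continuous_one_param_comp _ _ _ g_cont theta.
set phi := g \o gamma in cphi.
have [M gM] := torus_bounded g_cont.
have bphi y : `|phi y| <= M by apply: gM; exact: torus_one_param.
apply/cvgrPdist_le => e e0.
have e2 : 0 < e / 2 by rewrite divr_gt0.
have [N [w [s [w0 w1 s0 approx]]]] := haar_mean_approx e2.
pose S := \sum_(i < N) w i * (2 * M * s i).
near=> X.
have X0 : 0 < X by near: X; apply: nbhs_pinfty_gt; exact: num_real.
have XS : S / (e / 2) <= X by near: X; apply: nbhs_pinfty_ge; exact: num_real.
pose I := \int[lebesgue_measure]_(y in `[0, X]) phi y.
rewrite [leLHS](_ : _ = `|L - X^-1 * I|) //.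
have h1 : `|\sum_(i < N) w i * \int[lebesgue_measure]_(y in `[0, X]) phi (y + s i)
   - X * L| <= X * (e / 2).
  rewrite -Rintegral_sum_shift //; apply: Rintegral_near_cst => //.
  - by apply: etrans (lebesgue_itv (ltW X0)) _; rewrite subr0.
  - exact: integrable_sum_shift.
  - by move=> y _; rewrite distrC; exact: approx.
have h2 : `|\sum_(i < N) w i * \int[lebesgue_measure]_(y in `[0, X]) phi (y + s i)
   - I| <= S.
  rewrite -[I]mul1r -w1 mulr_suml -sumrB (le_trans (ler_norm_sum _ _ _)) //.
  apply: ler_sum => i _; rewrite -mulrBr normrM ger0_norm // ler_wpM2l //.
  by apply: Rintegral_shift_close => //; exact: ltW.
have h3 : `|X * L - I| <= X * e.
  rewrite ler_pdivrMr // in XS.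
  move: h1 h2 XS; set Z := \sum_(_ < _) _; rewrite !ler_norml; lra.
rewrite -(ler_pM2l X0) -[X in X * `|_|](gtr0_norm X0) -normrM mulrBr mulrA.
by rewrite divff ?gt_eqF // mul1r.
Unshelve. all: by end_near. Qed.

End Function.
End Equidistribution.

Unset Implicit Arguments.
Set Strict Implicit.

Theorem theorem1p4 (R : realType) (m n : nat) (theta : 'I_(m + n) -> R)
    (b : 'M[rat]_(m, n))
    (theta_basis :
      rat_basis (fun k : 'I_m => theta (lshift n k)) (rat_span theta))
    (theta_dep : forall j : 'I_n,
      theta (rshift m j) = \sum_(k < m) ratr (b k j) * theta (lshift n k))
    (mu : {measure set (borel_rV R (m + n)) -> \bar R})
    (mu_haar : normalized_haar (Hsub R b) mu)
    (f : 'rV[R[i]]_(m + n) -> R[i])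
    (f_cont : {within torus R (m + n), continuous f}) :
  (X^-1)%:C * cintegral lebesgue_measure `[0, X] (fun y => f (one_param theta y))
    @[X --> +oo] --> cintegral mu (Hsub R b) f.
Proof.
have [theta_free _] := theta_basis.
have re_cont : {within torus R (m + n), continuous (fun z => complex.Re (f z))}.
  apply/subspace_continuousP => z Tz; apply: cvg_Re.
  by move/subspace_continuousP: f_cont => /(_ z Tz).
have im_cont : {within torus R (m + n), continuous (fun z => complex.Im (f z))}.
  apply/subspace_continuousP => z Tz; apply: cvg_Im.
  by move/subspace_continuousP: f_cont => /(_ z Tz).
have re_lim := equidistribution_real theta_free theta_dep mu_haar re_cont.
have im_lim := equidistribution_real theta_free theta_dep mu_haar im_cont.
have scaleE (a x y : R) : a%:C * (x +i* y) = (a * x) +i* (a * y) by simpc.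
apply: cvg_complex; rewrite /cintegral; under eq_fun do rewrite scaleE.
  exact: re_lim.
exact: im_lim.
Qed.
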